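(* Let $X$ be a connected topological manifold of dimension at least two, let $\Gamma$ be a simple graph without loops on the vertex set $[n]=\{1,\dots,n\}$, and let ${\bf x}=(x_1,\dots,x_n)\in F(X,\Gamma)$ be a base point whose coordinates are pairwise distinct. Then there is a short exact sequence of groups $$1\longrightarrow P(X,\Gamma)\longrightarrow B(X,\Gamma)\longrightarrow \mathrm{Aut}(\Gamma)\longrightarrow 1,$$ where the first map is the inclusion and the second map sends $[c(\alpha)]$ to the unique $\sigma\in\mathrm{Aut}(\Gamma)$ with $\alpha(1)={\bf x}_\sigma$.
   Context: Let $E(\Gamma)$ be the edge set of $\Gamma$ and $\overline{jk}$ the edge joining $j,k$. The chromatic configuration space is $F(X,\Gamma)=\{(x_1,\dots,x_n)\in X^{\times n}\mid x_j\neq x_k \text{ for } \overline{jk}\in E(\Gamma)\}$ with the subspace topology. $\mathrm{Aut}(\Gamma)=\{\sigma\in\Sigma_n\mid \overline{\sigma(j)\sigma(k)}\in E(\Gamma)\iff\overline{jk}\in E(\Gamma)\}$ acts on $F(X,\Gamma)$ by $(\sigma,(x_1,\dots,x_n))\mapsto(x_{\sigma(1)},\dots,x_{\sigma(n)})$; products of permutations are read left to right: $(\sigma\tau)(i)=\tau(\sigma(i))$. Write ${\bf x}_\sigma=(x_{\sigma(1)},\dots,x_{\sigma(n)})$, and for a path $\alpha=(\alpha_1,\dots,\alpha_n):I=[0,1]\to F(X,\Gamma)$ write $\alpha_\sigma=(\alpha_{\sigma(1)},\dots,\alpha_{\sigma(n)})$. $\mathrm{Aut}(\Gamma)({\bf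 x})$ is the orbit of ${\bf x}$. Let $P(F(X,\Gamma),{\bf x},\mathrm{Aut}(\Gamma)({\bf x}))$ be the set of paths $\alpha:I\to F(X,\Gamma)$ with $\alpha(0)={\bf x}$ and $\alpha(1)\in\mathrm{Aut}(\Gamma)({\bf x})$. For such $\alpha$, the crossing-changeable braid $c(\alpha)=\{c(\alpha_1),\dots,c(\alpha_n)\}$ is the (unordered) collection of $n$ strings $c(\alpha_i)=\{(\alpha_i(s),s)\mid s\in I\}$ in $X\times I$. Equivalence: $c(\alpha)\sim c(\beta)$ if there are $n$ continuous maps $\widehat{h_i}:I\times I\to X\times I$, $\widehat{h_i}(s,t)=(h_i(s,t),s)$, $i=1,\dots,n$, such that (1) $h_i(s,0)=\alpha_i(s)$ and $h_i(s,1)=\beta_i(s)$; (2) $h_i(0,t)=\alpha_i(0)=\beta_i(0)$ and $h_i(1,t)=\alpha_i(1)=\beta_i(1)$; (3) for all $(s,t)\in I\times I$, if $\overline{jk}\in E(\Gamma)$ then $h_j(s,t)\neq h_k(s,t)$. The crossing-changeable braid group $B(X,\Gamma)$ is the set of equivalence classes $[c(\alpha)]$, $\alpha\in P(F(X,\Gamma),{\bf x},\mathrm{Aut}(\Gamma)({\bf x}))$, with operation $[c(\alpha)]\star[c(\beta)]=[c(\alpha\circ\beta_\sigma)]$ where $\alpha(1)={\bf x}_\sigma$ and $\circ$ is concatenation of paths (first $\alpha$, then $\beta_\sigma$). The pure crossing-changeable braid group $P(X,\Gamma)$ is the subgroup of classes $[c(\alpha)]$ with $\alpha(1)={\bf x}$.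 *)

(* Defs.v *)
From HB Require Import structures.
From mathcomp Require Import all_boot all_order all_algebra all_fingroup.
From mathcomp Require Import generic_quotient.
From mathcomp Require Import all_classical all_reals.
From mathcomp Require Import topology normedtype.
From mathcomp Require Import ring lra.

Set Implicit Arguments.
Unset Strict Implicit.
Unset Printing Implicit Defensive.
Import Order.TTheory GRing.Theory Num.Theory.
Import numFieldNormedType.Exports.

Local Open Scope classical_set_scope.
Local Open Scope ring_scope.

Definition unit_itv (R : realType) : set R := `[0, 1]%classic.
Arguments unit_itv R : clear implicits.

Definition homeomorphic (S T : topologicalType) :=
  exists (f : S -> T) (g : T -> S),
    [/\ continuous f, continuous g, cancel f g & cancel g f].

Definition locally_euclidean (R : realType) (d : nat) (X : topologicalType) :=
  forall p : X, exists (U : set X) (V : set 'rV[R]_d),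
    [/\ open U, U p, open V & homeomorphic U V].

(* Without boundary, Hausdorff and second countable, of pure dimension d. *)
Definition manifold (R : realType) (d : nat) (X : topologicalType) :=
  [/\ hausdorff_space X, @second_countable X & locally_euclidean R d X].

Section Continuity.
Variables (R : realType).
Local Notation I := (unit_itv R).
Implicit Types T Y Z : topologicalType.

Lemma comp_cts T Y Z (f : T -> Y) (g : Y -> Z) :
  continuous f -> continuous g -> continuous (fun t => g (f t)).
Proof. by move=> cf cg t; exact: (continuous_comp (cf t) (cg _)). Qed.

Lemma cst_cts T Y (y : Y) : continuous (fun _ : T => y).
Proof. by move=> t; exact: cvg_cst. Qed.

Lemma set_type_cts T Y (A : set Y) (f : T -> A) :
  continuous (fun t => val (f t)) -> continuous f.
Proof.
move=> /continuousP cf; apply/continuousP => _ [U oU <-].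
by rewrite -comp_preimage; exact: cf.
Qed.

Lemma val_cts Y (A : set Y) : continuous (fun a : A => val a).
Proof. exact: initial_continuous. Qed.

Lemma pair_cts T Y Z (f : T -> Y) (g : T -> Z) :
  continuous f -> continuous g -> continuous (fun t => (f t, g t)).
Proof. by move=> cf cg t; apply: cvg_pair; [exact: cf|exact: cg]. Qed.

Lemma fst_cts Y Z : continuous (fst : Y * Z -> Y).
Proof. by move=> p; exact: cvg_fst. Qed.

Lemma snd_cts Y Z : continuous (snd : Y * Z -> Z).
Proof. by move=> p; exact: cvg_snd. Qed.

Lemma glue_cts T Y (u : T -> R) (c : R) (f g : T -> Y) :
  continuous u -> continuous f -> continuous g ->
  (forall t, u t = c -> f t = g t) ->
  continuous (fun t => if u t <= c then f t else g t).
Proof.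
move=> cu cf cg fg t; rewrite /continuous_at.
have [ltc|gtc|eqc] := ltgtP (u t) c.
- apply: cvg_trans (cf t); apply: near_eq_cvg; near=> s.
  suff -> : u s <= c by [].
  by apply/ltW; near: s; exact: (cu t _ (lt_nbhsl ltc)).
- apply: cvg_trans (cg t); apply: near_eq_cvg; near=> s.
  suff -> : (u s <= c) = false by [].
  by apply/negbTE; rewrite -ltNge; near: s; exact: (cu t _ (lt_nbhsr gtc)).
- move=> U /= fU.
  have gU : nbhs (g t) U by rewrite -(fg t eqc).
  change (\forall s \near t, U (if u s <= c then f s else g s)).
  near=> s; case: (u s <= c).
    by near: s; exact: (cf t).
  by near: s; exact: (cg t).
Unshelve. all: by end_near. Qed.

Lemma max_cts T (f g : T -> R) :
  continuous f -> continuous g -> continuous (fun t => Num.max (f t) (g t)).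
Proof. by move=> cf cg t; exact: (continuous_max (cf t) (cg t)). Qed.

Lemma min_cts T (f g : T -> R) :
  continuous f -> continuous g -> continuous (fun t => Num.min (f t) (g t)).
Proof. by move=> cf cg t; exact: (continuous_min (cf t) (cg t)). Qed.

Lemma add_cts T (f g : T -> R) :
  continuous f -> continuous g -> continuous (fun t => f t + g t).
Proof. by move=> cf cg t; exact: (continuousD (cf t) (cg t)). Qed.

Lemma mul_cts T (f g : T -> R) :
  continuous f -> continuous g -> continuous (fun t => f t * g t).
Proof. by move=> cf cg t; exact: (continuousM (cf t) (cg t)). Qed.

Lemma opp_cts T (f : T -> R) : continuous f -> continuous (fun t => - f t).
Proof. by move=> cf t; exact: (continuousN (cf t)). Qed.

Lemma clamp_subproof (r : R) : Num.max 0 (Num.min r 1) \in I.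
Proof.
apply/mem_set; rewrite /unit_itv /= in_itv /=.
by apply/andP; split; rewrite ?le_max ?ge_max ?lexx ?ler01 ?ge_min ?lexx ?orbT.
Qed.

(* The retraction of R onto [0, 1]. It turns real expressions such as 2 s - 1
   into points of [0, 1]; it is the identity wherever the value matters. *)
Definition clamp (r : R) : I := exist (fun s => s \in I) _ (clamp_subproof r).

Lemma clamp_cts : continuous clamp.
Proof.
apply: set_type_cts => /=; apply: max_cts; first exact: cst_cts.
by apply: min_cts; [move=> r; exact: cvg_id|exact: cst_cts].
Qed.

Definition itv0 : I := clamp 0.
Definition itv1 : I := clamp 1.

Lemma itvP (s : I) : 0 <= val s <= 1.
Proof. by have := set_mem (valP s); rewrite /unit_itv /= in_itv. Qed.

Lemma clampE (r : R) : 0 <= r <= 1 -> val (clamp r) = r.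
Proof. by move=> /andP[r0 r1] /=; rewrite (min_l r1) (max_r r0). Qed.

Lemma val_itv0 : val itv0 = 0. Proof. by rewrite clampE ?lexx ?ler01. Qed.
Lemma val_itv1 : val itv1 = 1. Proof. by rewrite clampE ?lexx ?ler01. Qed.

Lemma clamp_val (s : I) : clamp (val s) = s.
Proof. by apply: val_inj; rewrite clampE ?itvP. Qed.

Lemma clamp_le0 (r : R) : r <= 0 -> clamp r = itv0.
Proof.
move=> r0; apply: val_inj; rewrite val_itv0 /=.
by rewrite max_l // ge_min r0.
Qed.

Lemma clamp_ge1 (r : R) : 1 <= r -> clamp r = itv1.
Proof.
by move=> r1; apply: val_inj; rewrite val_itv1 /= (min_r r1) max_r ?ler01.
Qed.

(* Concatenation: first a, then b, each at double speed. *)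
Definition pcat Y (a b : I -> Y) (s : I) : Y :=
  if val s <= 2^-1 then a (clamp (2 * val s)) else b (clamp (2 * val s - 1)).

Lemma pcat0 Y (a b : I -> Y) : pcat a b itv0 = a itv0.
Proof. by rewrite /pcat val_itv0 mulr0 invr_ge0 ler0n. Qed.

Lemma pcat1 Y (a b : I -> Y) : pcat a b itv1 = b itv1.
Proof.
rewrite /pcat val_itv1 mulr1; case: ifP => [|_];
  last by congr b; congr clamp; lra.
by move=> ?; exfalso; lra.
Qed.

Lemma pcat_comp Y Z (f : Y -> Z) (a b : I -> Y) s :
  f (pcat a b s) = pcat (fun s => f (a s)) (fun s => f (b s)) s.
Proof. by rewrite /pcat; case: ifP. Qed.

Lemma lin_cts T (k c : R) (f : T -> R) :
  continuous f -> continuous (fun t => k * f t + c).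
Proof.
move=> cf; apply: add_cts; last exact: cst_cts.
by apply: mul_cts => //; exact: cst_cts.
Qed.

Lemma pcat_cts_gen T Y (u : T -> I) (f g : T -> I -> Y) :
  continuous u ->
  continuous (fun p : T * I => f p.1 p.2) ->
  continuous (fun p : T * I => g p.1 p.2) ->
  (forall t, f t itv1 = g t itv0) ->
  continuous (fun t => pcat (f t) (g t) (u t)).
Proof.
move=> cu cf cg fg; rewrite /pcat.
have cvu : continuous (fun t => val (u t)).
  exact: comp_cts cu (@val_cts _ _).
apply: glue_cts => //.
- apply: (@comp_cts _ _ _ (fun t => (t, clamp (2 * val (u t)))) _ _ cf).
  apply: pair_cts; first by move=> t; exact: cvg_id.
  apply: comp_cts (@clamp_cts); apply: mul_cts => //; exact: cst_cts.
- apply: (@comp_cts _ _ _ (fun t => (t, clamp (2 * val (u t) - 1))) _ _ cg).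
  apply: pair_cts; first by move=> t; exact: cvg_id.
  by apply: comp_cts (@clamp_cts); exact: lin_cts.
- move=> t ->; rewrite clamp_ge1 ?clamp_le0 ?fg //; lra.
Qed.

Lemma pcat_cts Y (a b : I -> Y) :
  continuous a -> continuous b -> a itv1 = b itv0 -> continuous (pcat a b).
Proof.
move=> ca cb ab.
have := @pcat_cts_gen I Y id (fun=> a) (fun=> b); apply=> //.
- by move=> t; exact: cvg_id.
- exact: comp_cts (@snd_cts _ _) ca.
- exact: comp_cts (@snd_cts _ _) cb.
Qed.

(* Homotopy of paths relative to their endpoints, in an arbitrary space. *)
Definition phomot Y (a b : I -> Y) : Prop := exists H : I * I -> Y,
  [/\ continuous H,
      forall s, H (s, itv0) = a s /\ H (s, itv1) = b s,
      forall t, H (itv0, t) = a itv0 /\ a itv0 = b itv0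
    & forall t, H (itv1, t) = a itv1 /\ a itv1 = b itv1].

Lemma phomot_ends Y (a b : I -> Y) : phomot a b -> a itv0 = b itv0 /\ a itv1 = b itv1.
Proof. by case=> H [_ _ /(_ itv0)[_ ->] /(_ itv0)[_ ->]]. Qed.

Lemma phomot_refl Y (a : I -> Y) : continuous a -> phomot a a.
Proof.
move=> ca; exists (fun p => a p.1); split=> //.
exact: comp_cts (@fst_cts _ _) ca.
Qed.

Lemma phomot_sym Y (a b : I -> Y) : phomot a b -> phomot b a.
Proof.
case=> H [cH He H0 H1]; exists (fun p => H (p.1, clamp (1 - val p.2))); split.
- apply: comp_cts cH; apply: pair_cts; first exact: fst_cts.
  apply: comp_cts (@clamp_cts); apply: add_cts; first exact: cst_cts.
  by apply: opp_cts; exact: comp_cts (@snd_cts _ _) (@val_cts _ _).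
- by move=> s; cbn [fst snd]; rewrite val_itv0 val_itv1 subr0 subrr; have [-> ->] := He s.
- by move=> t /=; have [-> ->] := H0 (clamp (1 - val t)).
- by move=> t /=; have [-> ->] := H1 (clamp (1 - val t)).
Qed.

Lemma phomot_trans Y (b a c : I -> Y) : phomot a b -> phomot b c -> phomot a c.
Proof.
case=> H [cH He H0 H1] [K [cK Ke K0 K1]].
exists (fun p => pcat (fun t => H (p.1, t)) (fun t => K (p.1, t)) p.2); split.
- apply: pcat_cts_gen.
  + exact: snd_cts.
  + apply: comp_cts cH; apply: pair_cts; last exact: snd_cts.
    by apply: comp_cts (@fst_cts _ _) _; exact: fst_cts.
  + apply: comp_cts cK; apply: pair_cts; last exact: snd_cts.
    by apply: comp_cts (@fst_cts _ _) _; exact: fst_cts.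
  + by move=> p; have [_ ->] := He p.1; have [-> _] := Ke p.1.
- by move=> s /=; rewrite pcat0 pcat1; have [-> _] := He s; have [_ ->] := Ke s.
- move=> t /=; have [_ ab] := H0 t; have [_ bc] := K0 t; split; last by rewrite ab.
  by rewrite /pcat; case: ifP => _; [case: (H0 (clamp (2 * val t)))|
    case: (K0 (clamp (2 * val t - 1)))]; rewrite ?ab.
- move=> t /=; have [_ ab] := H1 t; have [_ bc] := K1 t; split; last by rewrite ab.
  by rewrite /pcat; case: ifP => _; [case: (H1 (clamp (2 * val t)))|
    case: (K1 (clamp (2 * val t - 1)))]; rewrite ?ab.
Qed.

Lemma phomot_cat Y (a a' b b' : I -> Y) : a itv1 = b itv0 ->
  phomot a a' -> phomot b b' -> phomot (pcat a b) (pcat a' b').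
Proof.
move=> ab [H [cH He H0 H1]] [K [cK Ke K0 K1]].
exists (fun p => pcat (fun s => H (s, p.2)) (fun s => K (s, p.2)) p.1); split.
- apply: pcat_cts_gen.
  + exact: fst_cts.
  + apply: comp_cts cH; apply: pair_cts; first exact: snd_cts.
    by apply: comp_cts (@fst_cts _ _) _; exact: snd_cts.
  + apply: comp_cts cK; apply: pair_cts; first exact: snd_cts.
    by apply: comp_cts (@fst_cts _ _) _; exact: snd_cts.
  + by move=> p; have [-> _] := H1 p.2; have [-> _] := K0 p.2.
- move=> s; rewrite /pcat /=; case: ifP => _; [exact: He|exact: Ke].
- by move=> t /=; rewrite !pcat0; exact: H0.
- by move=> t /=; rewrite !pcat1; exact: K1.
Qed.

Lemma phomot_comp Y Z (f : Y -> Z) (a b : I -> Y) : continuous f ->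
  phomot a b -> phomot (fun s => f (a s)) (fun s => f (b s)).
Proof.
move=> cf [H [cH He H0 H1]]; exists (fun p => f (H p)); split.
- exact: comp_cts cH cf.
- by move=> s; have [-> ->] := He s.
- by move=> t; have [-> ->] := H0 t.
- by move=> t; have [-> ->] := H1 t.
Qed.

Lemma phomot_repar Y (a : I -> Y) (phi psi : R -> R) : continuous a ->
  continuous phi -> continuous psi -> phi 0 = psi 0 -> phi 1 = psi 1 ->
  phomot (fun s => a (clamp (phi (val s)))) (fun s => a (clamp (psi (val s)))).
Proof.
move=> ca cphi cpsi e0 e1.
exists (fun p => a (clamp (phi (val p.1) + val p.2 * (psi (val p.1) - phi (val p.1))))).
have cv1 : continuous (fun p : I * I => val p.1).
  exact: comp_cts (@fst_cts _ _) (@val_cts _ _).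
have cv2 : continuous (fun p : I * I => val p.2).
  exact: comp_cts (@snd_cts _ _) (@val_cts _ _).
split.
- apply: comp_cts ca; apply: comp_cts (@clamp_cts).
  apply: add_cts; first exact: comp_cts cv1 cphi.
  apply: mul_cts => //; apply: add_cts; first exact: comp_cts cv1 cpsi.
  by apply: opp_cts; exact: comp_cts cv1 cphi.
- by move=> s; cbn [fst snd]; rewrite val_itv0 val_itv1 mul0r mul1r addr0 addrC subrK.
- by move=> t; cbn [fst snd]; rewrite val_itv0 e0 subrr mulr0 addr0.
- by move=> t; cbn [fst snd]; rewrite val_itv1 e1 subrr mulr0 addr0.
Qed.

Lemma id_cts : continuous (id : R -> R).
Proof. by move=> r; exact: cvg_id. Qed.

Lemma phomot_repar_eq Y (a b c : I -> Y) (phi psi : R -> R) : continuous a ->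
  continuous phi -> continuous psi -> phi 0 = psi 0 -> phi 1 = psi 1 ->
  (forall s, a (clamp (phi (val s))) = b s) ->
  (forall s, a (clamp (psi (val s))) = c s) -> phomot b c.
Proof.
by move=> ca cphi cpsi e0 e1 /funext <- /funext <-; exact: (phomot_repar ca cphi cpsi e0 e1).
Qed.

Lemma phomot_cat1l Y (a : I -> Y) : continuous a ->
  phomot (pcat (fun=> a itv0) a) a.
Proof.
move=> ca.
apply: (@phomot_repar_eq _ a _ _ (fun r => Num.max 0 (2 * r - 1)) id ca).
- by apply: max_cts; [exact: cst_cts|apply: lin_cts; exact: id_cts].
- exact: id_cts.
- by rewrite mulr0 sub0r max_l // oppr_le0.
- by rewrite mulr1 max_r; lra.
- move=> s; rewrite /pcat; have /andP[s0 s1] := itvP s; case: ifP => h.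
  + by rewrite clamp_le0 // ge_max lexx andTb; lra.
  + by rewrite max_r //; lra.
- by move=> s; rewrite clamp_val.
Qed.

Lemma phomot_cat1r Y (a : I -> Y) : continuous a ->
  phomot (pcat a (fun=> a itv1)) a.
Proof.
move=> ca.
apply: (@phomot_repar_eq _ a _ _ (fun r => Num.min 1 (2 * r)) id ca).
- apply: min_cts; first exact: cst_cts.
  by apply: mul_cts; [exact: cst_cts|exact: id_cts].
- exact: id_cts.
- by rewrite mulr0 min_r // ler01.
- by rewrite mulr1 min_l //; lra.
- move=> s; rewrite /pcat; have /andP[s0 s1] := itvP s; case: ifP => h.
  + by rewrite min_r //; lra.
  + by rewrite min_l // ?clamp_ge1 //; lra.
- by move=> s; rewrite clamp_val.
Qed.

Lemma phomot_catA Y (a b c : I -> Y) :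
  continuous a -> continuous b -> continuous c -> a itv1 = b itv0 -> b itv1 = c itv0 ->
  phomot (pcat (pcat a b) c) (pcat a (pcat b c)).
Proof.
move=> ca cb cc ab bc.
have cabc : continuous (pcat (pcat a b) c).
  by apply: pcat_cts => //; [exact: pcat_cts|rewrite pcat1].
apply: (@phomot_repar_eq _ (pcat (pcat a b) c) _ _ id
  (fun r => Num.max (2^-1 * r) (Num.max (r - 4^-1) (2 * r - 1))) cabc).
- exact: id_cts.
- apply: max_cts; first by apply: mul_cts; [exact: cst_cts|exact: id_cts].
  apply: max_cts; last by apply: lin_cts; exact: id_cts.
  by apply: add_cts; [exact: id_cts|exact: cst_cts].
- by rewrite mulr0 max_l // ge_max; apply/andP; split; lra.
- rewrite mulr1 [X in Num.max _ X]max_r ?max_r; lra.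
- by move=> s; rewrite clamp_val.
- move=> s; rewrite /pcat; have := itvP s; move: (val s) => r /andP[r0 r1] {s}.
  have [r2|r2] := leP r 2^-1.
    rewrite [Num.max (r - _) _]max_l ?max_l; [|lra..].
    rewrite clampE; last by apply/andP; split; lra.
    rewrite ifT; last lra.
    rewrite clampE; last by apply/andP; split; lra.
    rewrite ifT; last lra.
    by congr (a (clamp _)); lra.
  cbv iota; rewrite (@clampE (2 * r - 1)); last by apply/andP; split; lra.
  have [r3|r3] := leP (2 * r - 1) 2^-1.
    rewrite [Num.max (r - _) _]max_l ?max_r; [|lra..].
    rewrite clampE; last by apply/andP; split; lra.
    rewrite ifT; last lra.
    rewrite clampE; last by apply/andP; split; lra.
    rewrite ifF; last by apply/negbTE; rewrite -ltNge; lra.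
    by congr (b (clamp _)); lra.
  rewrite [Num.max (r - _) _]max_r ?max_r; [|lra..].
  rewrite clampE; last by apply/andP; split; lra.
  rewrite ifF; last by apply/negbTE; rewrite -ltNge; lra.
  by congr (c (clamp _)); lra.
Qed.

(* The reverse path s |-> a (1 - s). *)
Definition path_rev Y (a : I -> Y) (s : I) : Y := a (clamp (1 - val s)).

Lemma path_rev0 Y (a : I -> Y) : path_rev a itv0 = a itv1.
Proof. by rewrite /path_rev val_itv0 subr0. Qed.

Lemma path_rev1 Y (a : I -> Y) : path_rev a itv1 = a itv0.
Proof. by rewrite /path_rev val_itv1 subrr. Qed.

Lemma path_revK Y (a : I -> Y) : path_rev (path_rev a) =1 a.
Proof.
move=> s; rewrite /path_rev clampE; last by have /andP[? ?] := itvP s; apply/andP; split; lra.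
by rewrite opprB addrC subrK clamp_val.
Qed.

Lemma path_rev_cts Y (a : I -> Y) : continuous a -> continuous (path_rev a).
Proof.
move=> ca; apply: comp_cts ca; apply: comp_cts (@clamp_cts).
apply: add_cts; first exact: cst_cts.
by apply: opp_cts; exact: val_cts.
Qed.

Lemma phomot_catV Y (a : I -> Y) : continuous a ->
  phomot (pcat a (path_rev a)) (fun=> a itv0).
Proof.
move=> ca.
apply: (@phomot_repar_eq _ a _ _
  (fun r => Num.min (2 * r) (- 2 * r + 2)) (fun=> 0) ca).
- apply: min_cts; first by apply: mul_cts; [exact: cst_cts|exact: id_cts].
  by apply: lin_cts; exact: id_cts.
- exact: cst_cts.
- by rewrite mulr0 min_l; lra.
- by rewrite mulr1 min_r; lra.
- move=> s; rewrite /pcat /path_rev; have /andP[s0 s1] := itvP s; case: ifP => h.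
  + by rewrite min_l //; lra.
  + rewrite min_r ?clampE; [by congr (a (clamp _)); lra | by apply/andP; split; lra | lra].
- by [].
Qed.

Lemma phomot_catVl Y (a : I -> Y) : continuous a ->
  phomot (pcat (path_rev a) a) (fun=> a itv1).
Proof.
move=> ca; have := phomot_catV (path_rev_cts ca).
by rewrite (funext (path_revK a)) path_rev0.
Qed.

End Continuity.
Arguments itv0 {R}.
Arguments itv1 {R}.

Section Configurations.
Variables (n : nat) (X : topologicalType) (e : rel 'I_n).

(* The vertices 1, ..., n are encoded as 0, ..., n-1. {ptws 'I_n -> X} is the
   product space X^n; coerced to a type, config carries the subspace topology. *)
Definition config : set {ptws 'I_n -> X} :=
  [set x | forall j k, e j k -> x j <> x k].

Definition graph_aut : {set {perm 'I_n}} :=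
  [set s : {perm 'I_n} | [forall j, forall k, e (s j) (s k) == e j k]]%SET.

Lemma graph_autP (s : {perm 'I_n}) :
  reflect (forall j k, e (s j) (s k) = e j k) (s \in graph_aut).
Proof.
rewrite inE; apply: (iffP forallP) => [h j k|h j].
  by have /forallP/(_ k)/eqP := h j.
by apply/forallP => k; rewrite h.
Qed.

Lemma graph_aut_group_set : group_set graph_aut.
Proof.
apply/group_setP; split; first by apply/graph_autP => j k; rewrite !perm1.
move=> s t /graph_autP hs /graph_autP ht; apply/graph_autP => j k.
by rewrite !permM ht hs.
Qed.

Canonical graph_aut_group := Group graph_aut_group_set.

Lemma cact_subproof (s : [subg graph_aut]) (x : config) :
  ((fun i => val x (sgval s i)) : {ptws 'I_n -> X}) \in config.
Proof.
apply/mem_set => j k ejk; apply: (set_mem (valP x)).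
by have /graph_autP -> := subgP s.
Qed.

(* x_s = (x_s(1), ..., x_s(n)). In perm, (s * t) i = t (s i), which is the
   left-to-right convention; hence cactM below. *)
Definition cact (s : [subg graph_aut]) (x : config) : config :=
  exist (fun y : {ptws 'I_n -> X} => y \in config) _ (cact_subproof s x).

Lemma cactM (s t : [subg graph_aut]) x :
  cact (s * t)%g x = cact s (cact t x).
Proof. by apply: val_inj; apply/funext => i /=; rewrite permM. Qed.

Lemma cact1 x : cact 1%g x = x.
Proof. by apply: val_inj; apply/funext => i /=; rewrite perm1. Qed.

Lemma config_cts (T : topologicalType) (f : T -> config) :
  (forall i, continuous (fun t => val (f t) i)) -> continuous f.
Proof.
move=> cf; apply: set_type_cts => t; apply/cvg_sup => i.
move=> U [V [[W oW <-] Wt sWU]].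
by apply: (filterS sWU); apply: (cf i t); exact: open_nbhs_nbhs.
Qed.

Lemma coord_cts (i : 'I_n) : continuous (fun c : config => val c i).
Proof.
exact: (@comp_cts _ _ _ _ (fun y : {ptws _ -> X} => y i)
  (@val_cts _ config) (@proj_continuous _ (fun=> X) i)).
Qed.

Lemma cact_cts s : continuous (cact s).
Proof. by apply: config_cts => i; exact: coord_cts. Qed.

Lemma cact_comp_cts (T : topologicalType) (f : T -> config) s :
  continuous f -> continuous (fun t => cact s (f t)).
Proof. by move=> cf; exact: (comp_cts cf (@cact_cts s)). Qed.

End Configurations.
Arguments config {n} X e.

Section Braids.
Variables (R : realType) (n : nat) (X : topologicalType) (e : rel 'I_n).
Local Notation I := (unit_itv R).
Local Notation F := (config X e).

Definition orbit_path (x : F) : set (I -> F) :=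
  [set a | [/\ continuous a, a itv0 = x & range (fun s => cact s x) (a itv1)]].

Definition strand (u : I -> X) : set (X * I) := range (fun s => (u s, s)).

(* The unordered collection c(a) of the n strands of a. *)
Definition braid (a : I -> F) : set (set (X * I)) :=
  range (fun i => strand (fun s => val (a s) i)).

Definition ccbraid (x : F) : set (set (set (X * I))) :=
  [set braid a | a in orbit_path x].

Definition braid_homotopy (a b : I -> F) : Prop :=
  exists h : 'I_n -> I * I -> X,
    [/\ forall i, continuous (fun p => (h i p, p.1)),
        forall i s, h i (s, itv0) = val (a s) i /\ h i (s, itv1) = val (b s) i,
        forall i t, [/\ h i (itv0, t) = val (a itv0) i,
                        val (a itv0) i = val (b itv0) i,
                        h i (itv1, t) = val (a itv1) i
                      & val (a itv1) i = val (b itv1) i]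
      & forall p j k, e j k -> h j p <> h k p].

(* The relation is stated on the collections of strands; when the coordinates
   of the base point are distinct, a collection determines its indexed path
   (braid_inj), which makes this an equivalence relation. *)
Definition braid_equiv (x : F) (c c' : ccbraid x) : Prop :=
  exists a b, [/\ orbit_path x a, orbit_path x b,
                  val c = braid a, val c' = braid b & braid_homotopy a b].

Lemma braid_homotopyP (a b : I -> F) : braid_homotopy a b <-> phomot a b.
Proof.
split=> [[h [hc he hb hF]]|[H [cH He H0 H1]]].
  have hin p : ((fun i => h i p) : {ptws 'I_n -> X}) \in F.
    by apply/mem_set => j k; exact: hF.
  exists (fun p => exist (fun y : {ptws 'I_n -> X} => y \in F) _ (hin p)); split.
  - apply: config_cts => i /=.
    exact: (comp_cts (hc i) (@fst_cts X I)).
  - by move=> s; split; apply: val_inj; apply/funext => i /=; case: (he i s).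
  - by move=> t; split; apply: val_inj; apply/funext => i /=; case: (hb i t).
  - by move=> t; split; apply: val_inj; apply/funext => i /=; case: (hb i t).
exists (fun i p => val (H p) i); split.
- move=> i; apply: pair_cts (@fst_cts _ _).
  exact: comp_cts cH (@coord_cts _ _ _ i).
- by move=> i s; have [-> ->] := He s.
- by move=> i t; have [-> ->] := H0 t; have [-> ->] := H1 t.
- by move=> p j k; apply: (set_mem (valP (H p))).
Qed.

Section BraidGroup.
Variables (x : F) (x_inj : injective (val x)).
Local Notation P := (orbit_path x).

Lemma braid_inj (a b : I -> F) : P a -> P b -> braid a = braid b -> a = b.
Proof.
move=> [_ a0 _] [_ b0 _] ab; apply/funext => s; apply: val_inj; apply/funext => i.
have : braid a (strand (fun s => val (a s) i)) by exists i.
rewrite ab => -[j _ ji].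
have bj t : val (b t) j = val (a t) i.
  have : strand (fun s => val (b s) j) (val (b t) j, t) by exists t.
  by rewrite ji => -[u _ [E ut]]; rewrite -ut in E *; exact/esym.
suff ij : j = i by rewrite -(bj s) ij.
by apply: x_inj; rewrite -[in LHS]b0 bj a0.
Qed.

Lemma orbit_pathP (a : P) : P (val a).
Proof. exact: set_mem (valP a). Qed.

Lemma braid_equivP (a b : P) c c' : val c = braid (val a) ->
  val c' = braid (val b) -> @braid_equiv x c c' <-> phomot (val a) (val b).
Proof.
move=> ca cb; split=> [[a' [b' [Pa' Pb' ca' cb' /braid_homotopyP h]]]|h].
  have -> : val a = a'.
    by apply: (braid_inj (orbit_pathP a) Pa'); exact: etrans (esym ca) ca'.
  have -> // : val b = b'.
  by apply: (braid_inj (orbit_pathP b) Pb'); exact: etrans (esym cb) cb'.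
exists (val a), (val b); split=> //; try exact: orbit_pathP.
exact/braid_homotopyP.
Qed.

Lemma orbit_path_cts (a : P) : continuous (val a).
Proof. by have [] := set_mem (valP a). Qed.

Lemma orbit_path0 (a : P) : val a itv0 = x.
Proof. by have [] := set_mem (valP a). Qed.

Lemma orbit_path1 (a : P) : exists s, val a itv1 = cact s x.
Proof. by have [_ _ [s _ <-]] := set_mem (valP a); exists s. Qed.

Lemma ccbraid_path (c : ccbraid x) : exists a : P, val c = braid (val a).
Proof.
have [a Pa <-] := set_mem (valP c).
by exists (exist (fun a => a \in P) a (mem_set Pa)).
Qed.

Definition braid_eqb : rel (ccbraid x) := fun c c' => `[< braid_equiv c c' >].

Lemma braid_eqb_refl : reflexive braid_eqb.
Proof.
move=> c; have [a ca] := ccbraid_path c; apply/asboolP/(braid_equivP ca ca).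
exact/phomot_refl/orbit_path_cts.
Qed.

Lemma braid_eqb_sym : symmetric braid_eqb.
Proof.
move=> c c'; have [a ca] := ccbraid_path c; have [b cb] := ccbraid_path c'.
apply/asboolP/asboolP.
  by move=> /(braid_equivP ca cb) h; apply/(braid_equivP cb ca)/phomot_sym.
by move=> /(braid_equivP cb ca) h; apply/(braid_equivP ca cb)/phomot_sym.
Qed.

Lemma braid_eqb_trans : transitive braid_eqb.
Proof.
move=> c2 c1 c3; have [a1 ca1] := ccbraid_path c1.
have [a2 ca2] := ccbraid_path c2; have [a3 ca3] := ccbraid_path c3.
move=> /asboolP/(braid_equivP ca1 ca2) h12 /asboolP/(braid_equivP ca2 ca3) h23.
by apply/asboolP/(braid_equivP ca1 ca3); exact: phomot_trans h12 h23.
Qed.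

Canonical braid_eqb_equiv :=
  EquivRel braid_eqb braid_eqb_refl braid_eqb_sym braid_eqb_trans.

Definition braid_group := {eq_quot braid_eqb_equiv}%qT.
HB.instance Definition _ := Choice.on braid_group.
HB.instance Definition _ := EqQuotient.on braid_group.

Lemma ccbraid_subproof (a : P) : braid (val a) \in ccbraid x.
Proof. by apply/mem_set; exists (val a) => //; exact: set_mem (valP a). Qed.

Definition braid_class (a : P) : braid_group :=
  \pi_braid_group%qT
    (exist (fun c => c \in ccbraid x) _ (ccbraid_subproof a) : ccbraid x).

Lemma braid_classP (a b : P) :
  braid_class a = braid_class b <-> phomot (val a) (val b).
Proof.
set ca : ccbraid x := exist (fun c => c \in ccbraid x) _ (ccbraid_subproof a).
set cb : ccbraid x := exist (fun c => c \in ccbraid x) _ (ccbraid_subproof b).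
have <- : braid_equiv ca cb <-> phomot (val a) (val b) by exact: braid_equivP.
split=> [/eqmodP/asboolP //|h].
by apply/eqmodP/asboolP.
Qed.

Lemma braid_class_surj (g : braid_group) : exists a : P, g = braid_class a.
Proof.
rewrite -[g]reprK; have [a ca] := ccbraid_path (repr g); exists a.
by congr (\pi _)%qT; apply: val_inj.
Qed.

(* The s with a(1) = x_s, unique by cact_inj. *)
Definition aut_of (a : P) : [subg graph_aut e] := projT1 (cid (orbit_path1 a)).

Lemma aut_ofP (a : P) : val a itv1 = cact (aut_of a) x.
Proof. exact: projT2 (cid (orbit_path1 a)). Qed.

Lemma cact_inj (s t : [subg graph_aut e]) : cact s x = cact t x -> s = t.
Proof.
move=> /(congr1 val)/= st; apply/val_inj/permP => i; apply: x_inj.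
exact: (congr1 (fun f => f i) st).
Qed.

Definition path_star (s : [subg graph_aut e]) (a b : I -> F) : I -> F :=
  pcat a (fun t => cact s (b t)).

Lemma star_subproof (a b : P) : path_star (aut_of a) (val a) (val b) \in P.
Proof.
apply/mem_set; split.
- apply: pcat_cts; first exact: orbit_path_cts.
    by apply: cact_comp_cts; exact: orbit_path_cts.
  by rewrite orbit_path0 aut_ofP.
- by rewrite /path_star pcat0 orbit_path0.
- by exists (aut_of a * aut_of b)%g => //; rewrite /path_star pcat1 aut_ofP cactM.
Qed.

Definition path_mul (a b : P) : P :=
  exist (fun a => a \in P) _ (star_subproof a b).

Lemma aut_of_mul (a b : P) : aut_of (path_mul a b) = (aut_of a * aut_of b)%g.
Proof.
by apply: cact_inj; rewrite -aut_ofP /= /path_star pcat1 aut_ofP cactM.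
Qed.

Lemma path_one_subproof : (fun=> x) \in P.
Proof.
apply/mem_set; split=> //; first exact: cst_cts.
by exists 1%g => //; rewrite cact1.
Qed.

Definition path_one : P := exist (fun a => a \in P) _ path_one_subproof.

Lemma aut_of_one : aut_of path_one = 1%g.
Proof. by apply: cact_inj; rewrite -aut_ofP cact1. Qed.

Lemma path_inv_subproof (a : P) :
  (fun t => cact (aut_of a)^-1%g (path_rev (val a) t)) \in P.
Proof.
apply/mem_set; split.
- by apply: cact_comp_cts; apply: path_rev_cts; exact: orbit_path_cts.
- by rewrite path_rev0 aut_ofP -cactM mulVg cact1.
- by exists (aut_of a)^-1%g => //; rewrite path_rev1 orbit_path0.
Qed.

Definition path_inv (a : P) : P := exist (fun a => a \in P) _ (path_inv_subproof a).

Lemma aut_of_inv (a : P) : aut_of (path_inv a) = (aut_of a)^-1%g.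
Proof. by apply: cact_inj; rewrite -aut_ofP /= path_rev1 orbit_path0. Qed.

Definition braid_rep (g : braid_group) : P := projT1 (cid (braid_class_surj g)).

Lemma braid_repK g : braid_class (braid_rep g) = g.
Proof. by rewrite -(projT2 (cid (braid_class_surj g))). Qed.

(* Defined on chosen representatives; braid_classM states that any
   representatives give the same product. *)
Definition braid_mul (g h : braid_group) : braid_group :=
  braid_class (path_mul (braid_rep g) (braid_rep h)).
Definition braid_one : braid_group := braid_class path_one.
Definition braid_inv (g : braid_group) : braid_group :=
  braid_class (path_inv (braid_rep g)).

Lemma aut_of_homot (a b : P) : phomot (val a) (val b) -> aut_of a = aut_of b.
Proof. by move=> /phomot_ends[_ ab]; apply: cact_inj; rewrite -!aut_ofP. Qed.

Lemma path_mul_homot (a a' b b' : P) :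
  phomot (val a) (val a') -> phomot (val b) (val b') ->
  phomot (val (path_mul a b)) (val (path_mul a' b')).
Proof.
move=> ha hb; rewrite /= /path_star -(aut_of_homot ha).
apply: phomot_cat => //; first by rewrite orbit_path0 aut_ofP.
exact: phomot_comp (@cact_cts _ _ _ _) hb.
Qed.

Lemma braid_mul_class (a b : P) :
  braid_mul (braid_class a) (braid_class b) = braid_class (path_mul a b).
Proof. by apply/braid_classP/path_mul_homot; apply/braid_classP; rewrite braid_repK. Qed.

Lemma braid_inv_class (a : P) : braid_inv (braid_class a) = braid_class (path_inv a).
Proof.
apply/braid_classP => /=.
have /braid_classP h : braid_class (braid_rep (braid_class a)) = braid_class a.
  exact: braid_repK.
rewrite (aut_of_homot h); apply: phomot_comp; first exact: cact_cts.
have [H [cH He H0 H1]] := h; exists (fun p => H (clamp (1 - val p.1), p.2)).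
have cr : continuous (fun s : I => clamp (1 - val s)).
  apply: comp_cts (@clamp_cts R); apply: add_cts; first exact: cst_cts.
  by apply: opp_cts; exact: val_cts.
split.
- apply: comp_cts cH; apply: pair_cts (@snd_cts _ _).
  exact: comp_cts (@fst_cts _ _) cr.
- by move=> s; exact: He.
- by move=> t; rewrite !path_rev0; cbn [fst snd]; rewrite val_itv0 subr0; exact: H1.
- by move=> t; rewrite !path_rev1; cbn [fst snd]; rewrite val_itv1 subrr; exact: H0.
Qed.

Lemma braid_mulA : associative braid_mul.
Proof.
move=> g h k; have [a ->] := braid_class_surj g.
have [b ->] := braid_class_surj h; have [c ->] := braid_class_surj k.
rewrite !braid_mul_class; apply/braid_classP/phomot_sym.
rewrite /= aut_of_mul /path_star.
have -> : (fun t => cact (aut_of a) (pcat (val b) (fun u => cact (aut_of b) (val c u)) t)) =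
  pcat (fun t => cact (aut_of a) (val b t)) (fun t => cact (aut_of a * aut_of b)%g (val c t)).
  by apply/funext => t; rewrite pcat_comp; congr pcat; apply/funext => u; rewrite cactM.
apply: phomot_catA.
- exact: orbit_path_cts.
- by apply: cact_comp_cts; exact: orbit_path_cts.
- by apply: cact_comp_cts; exact: orbit_path_cts.
- by rewrite orbit_path0 aut_ofP.
- by rewrite orbit_path0 aut_ofP cactM.
Qed.

Lemma braid_mul1 : left_id braid_one braid_mul.
Proof.
move=> g; have [a ->] := braid_class_surj g; rewrite braid_mul_class.
apply/braid_classP; rewrite /= aut_of_one /path_star.
rewrite (_ : (fun t => cact 1%g (val a t)) = val a); last by apply/funext => t; rewrite cact1.
by have := phomot_cat1l (@orbit_path_cts a); rewrite orbit_path0.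
Qed.

Lemma braid_mulr1 : right_id braid_one braid_mul.
Proof.
move=> g; have [a ->] := braid_class_surj g; rewrite braid_mul_class.
apply/braid_classP; rewrite /= /path_star -aut_ofP.
exact/phomot_cat1r/orbit_path_cts.
Qed.

Lemma braid_mulV : left_inverse braid_one braid_inv braid_mul.
Proof.
move=> g; have [a ->] := braid_class_surj g.
rewrite braid_inv_class braid_mul_class; apply/braid_classP.
rewrite /= aut_of_inv /path_star.
have := phomot_comp (@cact_cts _ _ _ (aut_of a)^-1%g) (phomot_catVl (@orbit_path_cts a)).
rewrite aut_ofP -cactM mulVg cact1.
by rewrite (funext (pcat_comp (cact (aut_of a)^-1%g) (path_rev (val a)) (val a))).
Qed.

Lemma braid_mulrV : right_inverse braid_one braid_inv braid_mul.
Proof.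
move=> g; have [a ->] := braid_class_surj g.
rewrite braid_inv_class braid_mul_class; apply/braid_classP; rewrite /= /path_star.
rewrite (_ : (fun t => cact (aut_of a) _) = path_rev (val a)); last first.
  by apply/funext => t; rewrite -cactM mulgV cact1.
by have := phomot_catV (@orbit_path_cts a); rewrite orbit_path0.
Qed.

HB.instance Definition _ := isGroup.Build braid_group
  braid_mulA braid_mul1 braid_mulr1 braid_mulV braid_mulrV.

Lemma braid_classM (a b c : P) (s : [subg graph_aut e]) :
  val a itv1 = cact s x ->
  val c = pcat (val a) (fun t => cact s (val b t)) ->
  (braid_class a * braid_class b)%g = braid_class c.
Proof.
move=> as1 cE; rewrite [LHS]braid_mul_class; apply/braid_classP; rewrite cE.
have -> : s = aut_of a by apply: cact_inj; rewrite -as1 aut_ofP.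
by apply: phomot_refl; exact: (@orbit_path_cts (path_mul a b)).
Qed.

Definition pure_braid : pred braid_group :=
  fun g => `[< exists2 a : P, val a itv1 = x & g = braid_class a >].

Lemma aut_of_pure (a : P) : val a itv1 = x -> aut_of a = 1%g.
Proof. by move=> ax; apply: cact_inj; rewrite -aut_ofP cact1. Qed.

Lemma pure_braid_group_closed : group_closed pure_braid.
Proof.
split=> [|g h].
  by apply/asboolP; exists path_one.
move=> /asboolP[a a1 ->] /asboolP[b b1 ->]; apply/asboolP.
exists (path_mul a (path_inv b)).
  rewrite /= /path_star pcat1 path_rev1 orbit_path0 (aut_of_pure a1) (aut_of_pure b1).
  by rewrite invg1 !cact1.
rewrite [RHS](_ : _ = braid_mul (braid_class a) (braid_inv (braid_class b))) //.
by rewrite braid_inv_class braid_mul_class.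
Qed.

Definition pure_braid_group := {g : braid_group | pure_braid g}.
HB.instance Definition _ := SubChoice.on pure_braid_group.
HB.instance Definition _ := SubChoice_isSubGroup.Build braid_group pure_braid
  pure_braid_group pure_braid_group_closed.

End BraidGroup.
End Braids.
Arguments orbit_path R {n X e} x.

(* Exactness of 1 -> G -> H -> K -> 1. *)
Definition short_exact (G H K : groupType) (f : G -> H) (g : H -> K) :=
  [/\ {morph f : x y / (x * y)%g}, {morph g : x y / (x * y)%g}, injective f,
      range f = [set h | g h = 1%g] & range g = setT].

(* Main.v *)
Require Import Defs.
From mathcomp Require Import all_boot all_order all_algebra all_fingroup.
From mathcomp Require Import all_classical all_reals topology normedtype.
From mathcomp Require Import lra.

Set Implicit Arguments.
Unset Strict Implicit.
Unset Printing Implicit Defensive.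
Import Order.TTheory GRing.Theory Num.Theory.
Import numFieldNormedType.Exports.
Local Open Scope classical_set_scope.
Local Open Scope ring_scope.

(** Sending a class to the unique s with a(1) = x_s is a well-defined group
    morphism because homotopies fix endpoints and concatenation multiplies
    these permutations; its kernel is the pure braid group by definition. What
    remains is surjectivity: for every automorphism s there must be a path in
    the configuration space from x to x_s. The path produced keeps all the
    coordinates pairwise distinct, whatever the graph.

    The topological input is [finite_setC_joined]: the complement of a finite
    set S in a connected manifold of dimension at least two is path connected.
    A ball of a normed space of dimension at least two stays path connected
    when its centre is removed ([punctured_ball_joined]): a segment passing
    through the centre is replaced by two segments through a point off that
    line. Charts carry this to X, so every point has a small neighbourhood W
    with W minus S nonempty and connected by paths avoiding S
    ([manifold_ball_finite]). The set of points near which everything outside S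
    can be reached from a given point is then open and closed.

    A single coordinate can therefore be moved freely in the complement of the
    other ones. Using a spare point, three such moves exchange two coordinates
    ([distinct_joined_tperm]), and transpositions generate all permutations
    ([distinct_joined_perm]). *)

(** * Points joined by a path inside a subset *)

(** The path takes its values in the whole space T and stays in A, so that A
    needs no topology of its own. *)
Definition joined (R : realType) (T : topologicalType) (A : set T) (a b : T) :=
  exists g : unit_itv R -> T,
    [/\ continuous g, g itv0 = a, g itv1 = b & forall s, A (g s)].
Arguments joined R {T} A a b.

Section Joined.
Variable R : realType.
Implicit Types T : topologicalType.

Lemma joined_refl T (A : set T) a : A a -> joined R A a a.
Proof. by move=> Aa; exists (fun=> a); split=> //; exact: cst_cts. Qed.

Lemma joined_sym T (A : set T) a b : joined R A a b -> joined R A b a.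
Proof.
case=> g [cg g0 g1 Ag]; exists (path_rev g); split=> //.
- exact: path_rev_cts.
- by rewrite path_rev0.
- by rewrite path_rev1.
- by move=> s; exact: Ag.
Qed.

Lemma joined_trans T (A : set T) b a c :
  joined R A a b -> joined R A b c -> joined R A a c.
Proof.
case=> g [cg g0 g1 Ag] [h [ch h0 h1 Ah]]; exists (pcat g h); split=> //.
- by apply: pcat_cts => //; rewrite g1 h0.
- by rewrite pcat0.
- by rewrite pcat1.
- by move=> s; rewrite /pcat; case: ifP.
Qed.

Lemma joined_sub T (A B : set T) a b :
  A `<=` B -> joined R A a b -> joined R B a b.
Proof. by move=> AB [g [cg g0 g1 Ag]]; exists g; split=> // s; exact/AB/Ag. Qed.

(** The map h is continuous on the subspace V only, while the path in A is
    given in the ambient space T. *)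
Lemma joined_image T T' (V A : set T) (h : V -> T') (u v : V) :
  continuous h -> A `<=` V -> joined R A (val u) (val v) ->
  joined R [set h w | w in [set w : V | A (val w)]] (h u) (h v).
Proof.
move=> ch AV [g [cg g0 g1 Ag]].
have gV s : g s \in V by exact/mem_set/AV.
exists (fun s => h (exist (fun w => w \in V) _ (gV s))); split.
- by apply: comp_cts ch; exact: set_type_cts.
- by congr h; apply: val_inj.
- by congr h; apply: val_inj.
- by move=> s; exists (exist (fun w => w \in V) _ (gV s)) => //=.
Qed.

End Joined.

(** * Balls and punctured balls in a normed space *)

Section PuncturedBall.
Variables (R : realType) (V : normedModType R).
Implicit Types (a b c u v w : V) (r : R).

Lemma joined_segment (A : set V) a b :
  (forall t : R, 0 <= t <= 1 -> A ((1 - t) *: a + t *: b)) -> joined R A a b.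
Proof.
move=> sA; exists (fun s => (1 - val s) *: a + val s *: b); split.
- have cZ (k : unit_itv R -> R) v : continuous k -> continuous (fun s => k s *: v).
    move=> ck s; exact: (cvg_comp _ _ (ck s) (@scalel_continuous _ _ v (k s))).
  have c1 : continuous (fun s : unit_itv R => 1 - val s).
    by apply: add_cts; [exact: cst_cts|apply: opp_cts; exact: val_cts].
  by move=> s; exact: (cvgD (cZ _ a c1 s) (cZ _ b (@val_cts _ _) s)).
- by rewrite val_itv0 scale0r addr0 subr0 scale1r.
- by rewrite val_itv1 scale1r subrr scale0r add0r.
- by move=> s; exact/sA/Defs.itvP.
Qed.

Lemma segment_subr a b c (t : R) :
  (1 - t) *: a + t *: b - c = (1 - t) *: (a - c) + t *: (b - c).
Proof.
rewrite !scalerBr addrACA -opprD -scalerDl.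
by rewrite subrK scale1r.
Qed.

Lemma ball_segment c r a b t : ball c r a -> ball c r b -> 0 <= t <= 1 ->
  ball c r ((1 - t) *: a + t *: b).
Proof.
rewrite -ball_normE /= => ca cb /andP[t0 t1].
rewrite distrC segment_subr; apply: le_lt_trans (ler_normD _ _) _.
rewrite !normrZ (ger0_norm t0) ger0_norm ?subr_ge0 //.
rewrite (distrC a) (distrC b).
have [->|tn1] := eqVneq t 1; first by rewrite subrr mul0r add0r mul1r.
have -> : r = (1 - t) * r + t * r by rewrite -mulrDl subrK mul1r.
apply: ltr_leD; last by rewrite ler_wpM2l // ltW.
by rewrite ltr_pM2l // subr_gt0 lt_neqAle tn1.
Qed.

Lemma ball_joined c r a b : ball c r a -> ball c r b -> joined R (ball c r) a b.
Proof. by move=> ca cb; apply: joined_segment => t; exact: ball_segment. Qed.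

(** A segment through c has ends whose directions from c are proportional. *)
Lemma punctured_segment c r a b : ball c r a -> ball c r b -> a <> c ->
  (forall k : R, b - c <> k *: (a - c)) -> joined R (ball c r `\ c) a b.
Proof.
move=> ca cb ac nab; apply: joined_segment => t t01.
split; first exact: ball_segment.
move=> /= /eqP; rewrite -subr_eq0 segment_subr => /eqP h.
have [t0|tn0] := eqVneq t 0.
  move: h; rewrite t0 subr0 scale1r scale0r addr0 => /eqP.
  by rewrite subr_eq0 => /eqP.
apply: (nab (- (t^-1 * (1 - t)))); rewrite scaleNr -scalerA.
move/eqP: h; rewrite addrC addr_eq0 => /eqP h.
by rewrite -scalerN -h scalerA mulVf // scale1r.
Qed.

(** Every direction w has a nonzero multiple short enough to remain in the
    ball. *)
Lemma ball_along c r w : 0 < r -> exists2 k : R, k != 0 & ball c r (c + k *: w).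
Proof.
move=> r0; (* 1 + |w| rather than |w|, since w may be zero *)
exists (r / (1 + `|w|) / 2).
  by rewrite gt_eqF // !divr_gt0 // ltr_pwDl.
have w1 : 0 < 1 + `|w| by rewrite ltr_pwDl.
rewrite -ball_normE /= opprD addNKr normrN normrZ.
rewrite gtr0_norm ?divr_gt0 // mulrAC ltr_pdivrMr // mulrAC ltr_pdivrMr //.
have := normr_ge0 w; nra.
Qed.

(* The dimension is at least two: no line contains every vector. *)
Hypothesis noncollinear : forall u, exists w, forall k : R, w <> k *: u.

Lemma punctured_ball_joined c r a b :
  (ball c r `\ c) a -> (ball c r `\ c) b -> joined R (ball c r `\ c) a b.
Proof.
move=> [ca ac] [cb bc]; case: (pselect (exists k : R, b - c = k *: (a - c))); last first.
  by move=> h; apply: punctured_segment => // k abk; apply: h; exists k.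
case=> k bk; have k0 : k != 0.
  by apply/eqP => k0; apply: bc; apply/eqP; rewrite -subr_eq0 bk k0 scale0r.
have r0 : 0 < r by move: ca; rewrite -ball_normE /=; exact: le_lt_trans.
(* a, b and c are aligned: go through a point off their line *)
have [w nw] := noncollinear (a - c).
have [m m0 cm] := ball_along c w r0.
have cmw : c + m *: w - c = m *: w by rewrite addrC addKr.
apply: (@joined_trans _ _ _ (c + m *: w)).
  apply: punctured_segment => // l; rewrite cmw => E; apply: (nw (m^-1 * l)).
  by rewrite -scalerA -E scalerA mulVf // scale1r.
apply: joined_sym; apply: punctured_segment => // l; rewrite cmw bk => E.
apply: (nw (m^-1 * (l * k))).
by rewrite -!scalerA -E scalerA mulVf // scale1r.
Qed.

Lemma punctured_ball_neq0 c r : 0 < r -> exists a, (ball c r `\ c) a.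
Proof.
move=> r0; have [w nw] := noncollinear 0; have [k k0 ck] := ball_along c w r0.
exists (c + k *: w); split=> //= /eqP.
rewrite -subr_eq0 addrC addKr scaler_eq0 (negbTE k0) /= => /eqP w0.
by apply: (nw 0); rewrite scale0r.
Qed.

End PuncturedBall.

Lemma rV_noncollinear (R : realType) d (u : 'rV[R]_d) : (2 <= d)%N ->
  exists w : 'rV[R]_d, forall k : R, w <> k *: u.
Proof.
case: d u => [|[|d]] // u _.
have [u0|u0] := eqVneq (u 0 0) 0.
  exists (delta_mx 0 0) => k /rowP/(_ 0).
  by rewrite !mxE u0 mulr0 eqxx => /eqP; rewrite oner_eq0.
exists (delta_mx 0 1) => k /rowP h.
have := h 0; rewrite !mxE /= => /esym/eqP; rewrite mulf_eq0 (negbTE u0) orbF.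
move/eqP=> k0; have := h 1; rewrite !mxE k0 mul0r eqxx => /eqP.
by rewrite oner_eq0.
Qed.

Lemma open_subset_nbhs (T : topologicalType) (U : set T) (p : U) (O : set U) :
  open U -> nbhs p O -> nbhs (val p) [set val q | q in O].
Proof.
move=> oU [_ [[W oW <-] Wp] sWO].
apply: (@filterS _ _ _ (U `&` W)).
  move=> q [Uq Wq]; exists (exist (fun q => q \in U) _ (mem_set Uq)) => //.
  by apply: sWO.
apply: open_nbhs_nbhs; split; first exact: openI.
by split=> //; exact/set_mem/valP.
Qed.

(** * Complements of finite sets in a manifold *)

Section Manifold.
Variables (R : realType) (d : nat) (X : topologicalType).
Hypotheses (d_ge2 : (2 <= d)%N) (X_eucl : locally_euclidean R d X).

(** The inverse of a chart around p, as an open embedding h of an open subset V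
    of the coordinate space into X. *)
Lemma euclidean_chart (p : X) : exists (V : set 'rV[R]_d) (h : V -> X) (c : V),
  [/\ open V, continuous h, injective h, h c = p &
      forall O : set V, nbhs c O -> nbhs p (h @` O)].
Proof.
have [U [V [oU Up oV [f [g [cf cg fK gK]]]]]] := X_eucl p.
pose q : U := exist (fun q => q \in U) p (mem_set Up).
exists V, (fun v => val (g v)), (f q); split=> //.
- exact: comp_cts cg (@val_cts _ _).
- by move=> v w /val_inj/(can_inj gK).
- by rewrite fK.
- move=> O Oc.
  have : nbhs q (f @^-1` O) by exact: cf.
  move=> /(open_subset_nbhs oU); apply: filterS => _ [z Oz <-].
  by exists (f z) => //; rewrite fK.
Qed.

(** Small coordinate balls W around p, path connected with or without p. *)
Lemma manifold_ball (p : X) (N : set X) : nbhs p N -> exists W : set X,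
  [/\ nbhs p W, W `<=` N, exists q, (W `\ p) q,
      forall a b, W a -> W b -> joined R W a b &
      forall a b, (W `\ p) a -> (W `\ p) b -> joined R (W `\ p) a b].
Proof.
move=> Np; have [V [h [c [oV ch ih hc nh]]]] := euclidean_chart p.
have nV : nbhs (val c) V by apply: open_nbhs_nbhs; split=> //; exact: set_mem (valP c).
have : nbhs c (h @^-1` N) by apply: ch; rewrite hc.
move=> /(open_subset_nbhs oV)/nbhs_ballP[r /= r0 sr].
pose B : set 'rV[R]_d := ball (val c) r; have sBV : B `<=` V.
  by move=> z /sr[w _ <-]; exact: set_mem (valP w).
have noncol := fun u => @rV_noncollinear R d u d_ge2.
pose im (A : set 'rV[R]_d) := [set h w | w in [set w : V | A (val w)]].
have imD : im B `\ p = im (B `\ val c).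
  apply/seteqP; split=> [_ [[w Bw <-] wp]|_ [w [Bw wc] <-]].
    by exists w => //; split=> // E; apply: wp; rewrite (val_inj (E : val w = val c)).
  split; first by exists w.
  by move=> E; apply: wc; rewrite (ih w c (etrans E (esym hc))).
exists (im B); split.
- apply: nh; apply: (val_cts (A := V)); exact: nbhsx_ballx.
- by move=> _ [w /sr[w' Nw' E] <-]; rewrite -(val_inj (E : val w' = val w)).
- have [a Ba] := punctured_ball_neq0 noncol (val c) r0.
  have aV : a \in V by exact/mem_set/sBV/Ba.1.
  pose w : V := exist (fun w => w \in V) _ aV.
  suff : (im B `\ p) (h w) by exists (h w).
  by rewrite imD; exists w.
- move=> _ _ [u Bu <-] [v Bv <-]; apply: joined_image => //.
  exact: ball_joined.
- suff : forall a b, im (B `\ val c) a -> im (B `\ val c) b ->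
      joined R (im (B `\ val c)) a b by rewrite -imD.
  move=> _ _ [u Bu <-] [v Bv <-]; apply: joined_image => //.
    exact: subset_trans (@subDsetl _ _ _) sBV.
  exact: punctured_ball_joined.
Qed.

Hypothesis X_hausdorff : hausdorff_space X.

(** W is taken so small that it contains no point of S except possibly p. *)
Lemma manifold_ball_finite (S : set X) (p : X) (N : set X) :
  finite_set S -> nbhs p N -> exists W : set X,
  [/\ nbhs p W, W `<=` N, exists q, (W `\` S) q &
      forall a b, (W `\` S) a -> (W `\` S) b -> joined R (~` S) a b].
Proof.
move=> fS Np.
have cS : closed (S `\ p).
  apply: (accessible_finite_set_closed.1 (hausdorff_accessible X_hausdorff)).
  exact: finite_setD.
have /manifold_ball[W [Wp WN [q [Wq qp]] jW jWp]] : nbhs p (N `&` ~` (S `\ p)).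
  apply: filterI => //; apply: open_nbhs_nbhs; split; first exact: closed_openC.
  by move=> [_]; apply.
have WS a : W a -> a <> p -> ~ S a by move=> /WN[_ nS] ap Sa; apply: nS.
exists W; split=> //.
- by move=> a /WN[].
- by exists q; split=> //; exact: WS.
- move=> a b [Wa Sa] [Wb Sb].
  case: (pselect (S p)) => Sp.
    apply: (@joined_sub _ _ (W `\ p)); first by move=> z [Wz zp]; exact: WS.
    by apply: jWp; split=> // E; [apply: Sa|apply: Sb]; rewrite E.
  apply: (@joined_sub _ _ W); last exact: jW.
  by move=> z Wz Sz; case: (pselect (z = p)) => [zp|/WS]; [apply: Sp; rewrite -zp|apply].
Qed.

Hypothesis X_connected : connected [set: X].

Lemma finite_setC_joined (S : set X) (a b : X) : finite_set S ->
  ~ S a -> ~ S b -> joined R (~` S) a b.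
Proof.
move=> fS Sa Sb.
(* The interior of B is shown to be nonempty, open and closed. *)
pose B := [set q | ~ S q -> joined R (~` S) a q].
have BE p (W : set X) q : nbhs p W ->
    (forall u v, (W `\` S) u -> (W `\` S) v -> joined R (~` S) u v) ->
    (W `\` S) q -> joined R (~` S) a q -> B° p.
  move=> Wp jW Wq aq; apply: filterS Wp => z Wz Sz.
  by apply: joined_trans aq _; exact: jW.
suff BT : B° = [set: X] by have := @interior_subset _ B b; rewrite BT; apply.
apply: X_connected.
- exists a; have [W [Wa _ _ jW]] := manifold_ball_finite fS (@filterT _ (nbhs a) _).
  apply: (BE _ _ a Wa jW); first by split=> //; exact: nbhs_singleton.
  exact: joined_refl.
- by exists B°; [exact: open_interior|rewrite setTI].
- exists B°; rewrite ?setTI // => p clp.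
  have [W [Wp _ _ jW]] := manifold_ball_finite fS (@filterT _ (nbhs p) _).
  have [q [Bq Wq]] := clp _ (nbhs_interior Wp).
  have : nbhs q (B `&` W) by apply: filterI.
  (* the neighbourhood B `&` W of q contains a point z outside S *)
  move=> /(manifold_ball_finite fS)[W' [_ W'B [z [W'z Sz]] _]].
  have [Bz Wz] := W'B _ W'z.
  by apply: (BE _ _ z Wp jW) => //; exact: Bz.
Qed.

(** * Paths of tuples of distinct points *)

Section Configurations.
Variables (n : nat).
Implicit Types u v : 'I_n -> X.

(** The n-tuples u and v are the ends of a path of tuples of pairwise distinct
    points, that is, of a path in the configuration space of the complete graph. *)
Definition distinct_joined u v := exists h : unit_itv R -> 'I_n -> X,
  [/\ forall i, continuous (h^~ i), h itv0 = u, h itv1 = v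
    & forall s, injective (h s)].

Lemma distinct_joined_refl u : injective u -> distinct_joined u u.
Proof. by move=> iu; exists (fun=> u); split=> // i; exact: cst_cts. Qed.

Lemma distinct_joined_trans v u w :
  distinct_joined u v -> distinct_joined v w -> distinct_joined u w.
Proof.
case=> g [cg g0 g1 ig] [h [ch h0 h1 ih]].
exists (fun s i => pcat (g^~ i) (h^~ i) s); split.
- by move=> i; apply: pcat_cts => //; rewrite g1 h0.
- by apply/funext => i; rewrite pcat0 g0.
- by apply/funext => i; rewrite pcat1 h1.
- by move=> s i j; rewrite /pcat; case: ifP => _; [exact: ig|exact: ih].
Qed.

(** The tuple u with its i-th entry replaced by z. *)
Definition moved u (i : 'I_n) (z : X) : 'I_n -> X :=
  fun j => if j == i then z else u j.

Lemma moved_inj u i z : injective u -> (forall j, j != i -> u j <> z) ->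
  injective (moved u i z).
Proof.
move=> iu uz j k; rewrite /moved; case: eqVneq => [->|ji]; case: eqVneq => [->|ki] //.
- by move/esym/uz; case/(_ ki).
- by move/uz; case/(_ ji).
- exact: iu.
Qed.

Lemma distinct_joined_moved u i z : injective u -> (forall j, j != i -> u j <> z) ->
  distinct_joined u (moved u i z).
Proof.
move=> iu uz; pose S := [set u j | j in [set j | j != i]].
have fS : finite_set S by apply: finite_image; exact: finite_finset.
have [||g [cg g0 g1 Sg]] := @finite_setC_joined S (u i) z fS.
- by move=> [j /= ji /iu E]; rewrite E eqxx in ji.
- by move=> [j /= ji]; exact: uz.
exists (fun s => moved u i (g s)); split.
- by move=> j; rewrite /moved; case: eqP => _ //; exact: cst_cts.
- by apply/funext => j; rewrite /moved g0; case: eqP => // ->.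
- by rewrite g1.
- by move=> s; apply: moved_inj => // j ji E; apply: (Sg s); exists j.
Qed.

(** With a spare point z: entry i goes to z, entry j to the former place of
    entry i, then entry i to the former place of entry j. *)
Lemma distinct_joined_tperm u i j : injective u ->
  distinct_joined u (fun k => u (tperm i j k)).
Proof.
move=> iu; have [<-|ij] := eqVneq i j.
  by rewrite tperm1; under eq_fun do rewrite perm1; exact: distinct_joined_refl.
have fu : finite_set (range u) by apply: finite_image; exact: finite_finset.
have [_ [_ _ [z [_ uz]] _]] := manifold_ball_finite fu (@filterT _ (nbhs (u i)) _).
have {}uz k : u k <> z by move=> E; apply: uz; exists k.
have iv : injective (moved u i z) by apply: moved_inj.
have vi k : k != j -> moved u i z k <> u i.
  rewrite /moved; case: (eqVneq k i) => [_ _ E|ki _ E]; first exact: (uz i (esym E)).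
  by rewrite (iu _ _ E) eqxx in ki.
have iw : injective (moved (moved u i z) j (u i)) by apply: moved_inj.
have wi k : k != i -> moved (moved u i z) j (u i) k <> u j.
  rewrite /moved; case: (eqVneq k j) => [_ _ E|kj /negbTE -> E].
    by rewrite (iu _ _ E) eqxx in ij.
  by rewrite (iu _ _ E) eqxx in kj.
apply: (@distinct_joined_trans (moved u i z)); first exact: distinct_joined_moved.
apply: (@distinct_joined_trans (moved (moved u i z) j (u i))).
  exact: distinct_joined_moved.
suff -> : (fun k => u (tperm i j k)) = moved (moved (moved u i z) j (u i)) i (u j).
  exact: distinct_joined_moved.
apply/funext => k; rewrite /moved; case: tpermP => [->|->|/eqP/negbTE -> /eqP/negbTE -> //].
  by rewrite eqxx.
by rewrite eqxx eq_sym (negbTE ij).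
Qed.

Lemma distinct_joined_perm u (s : {perm 'I_n}) : injective u ->
  distinct_joined u (fun k => u (s k)).
Proof.
move=> iu; have [ts -> _] := prod_tpermP s; elim: ts => [|[i j] ts IH].
  by rewrite big_nil; under eq_fun do rewrite perm1; exact: distinct_joined_refl.
rewrite big_cons; apply: distinct_joined_trans IH _.
under [X in distinct_joined _ X]eq_fun do rewrite permM.
apply: (@distinct_joined_tperm (fun k => u ((\prod_(t <- ts) tperm t.1 t.2)%g k))).
by move=> k l /iu/perm_inj.
Qed.

End Configurations.
End Manifold.

(** * The exact sequence *)

Section Automorphisms.
Variables (R : realType) (n : nat) (X : topologicalType) (e : rel 'I_n).
Variable x : config X e.

(** Pairwise distinct entries satisfy the constraints of any loopless graph. *)
Lemma distinct_joined_orbit_path (s : [subg graph_aut e]) : irreflexive e ->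
  distinct_joined R (val x) (fun k => val x (sgval s k)) ->
  exists a : orbit_path R x, val a itv1 = cact s x.
Proof.
move=> e_irr [h [ch h0 h1 ih]].
have hF t : (h t : {ptws 'I_n -> X}) \in config X e.
  by apply/mem_set => j k ejk /ih jk; rewrite jk e_irr in ejk.
pose a t : config X e := exist (fun y : {ptws 'I_n -> X} => y \in config X e) _ (hF t).
have a1 : a itv1 = cact s x by apply: val_inj.
have aP : a \in orbit_path R x.
  apply/mem_set; split; [exact: config_cts|exact: val_inj|].
  by exists s.
by exists (exist (fun a => a \in orbit_path R x) _ aP).
Qed.

End Automorphisms.

Theorem theorem1p2 (R : realType) (d n : nat) (X : topologicalType)
    (e : rel 'I_n) (x : config X e)
    (d_ge2 : (2 <= d)%N)
    (X_manifold : manifold R d X)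
    (X_connected : connected [set: X])
    (e_sym : symmetric e)
    (e_irr : irreflexive e)
    (x_inj : injective (val x)) :
  exists pi : braid_group R x_inj -> [subg graph_aut e],
    (forall (a : orbit_path R x) (s : [subg graph_aut e]),
       pi (braid_class x_inj a) = s <-> val a itv1 = cact s x) /\
    short_exact (val : pure_braid_group R x_inj -> braid_group R x_inj) pi.
Proof.
have [X_hausdorff _ X_eucl] := X_manifold.
pose pi (g : braid_group R x_inj) := aut_of (braid_rep g).
have piE (a : orbit_path R x) : pi (braid_class x_inj a) = aut_of a.
  by apply: (aut_of_homot x_inj); apply/(braid_classP x_inj); rewrite braid_repK.
have pi_end (a : orbit_path R x) s :
    pi (braid_class x_inj a) = s <-> val a itv1 = cact s x.
  rewrite piE aut_ofP; split=> [-> //|]; exact: (cact_inj x_inj).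
exists pi; split=> //; split.
- by [].
- move=> g h; have [a ->] := braid_class_surj g; have [b ->] := braid_class_surj h.
  rewrite [X in pi X](braid_mul_class x_inj a b) !piE; exact: aut_of_mul.
- exact: val_inj.
- apply/seteqP; split=> [_ [g _ <-]|g].
    have /asboolP[a a1 ->] := valP g.
    by apply/pi_end; rewrite cact1.
  have [a ->] := braid_class_surj g => /pi_end; rewrite cact1 => a1.
  have pa : pure_braid (braid_class x_inj a) by apply/asboolP; exists a.
  by exists (exist (fun g => pure_braid g) _ pa).
- apply/seteqP; split=> // s _.
  have [a /pi_end <-] := distinct_joined_orbit_path e_irr
    (distinct_joined_perm d_ge2 X_eucl X_hausdorff X_connected (sgval s) x_inj).
  by exists (braid_class x_inj a).
Qed.
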